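(* Let $N$ be a square-free positive integer, and let $E_k^{(N)}$ be the holomorphic Eisenstein series of $\Gamma_0(N)^+$, $$E_k^{(N)}(z)=\sum_{\gamma\in\Gamma_\infty(N)\backslash\Gamma_0(N)^+}(cz+d)^{-k},\qquad \gamma=\begin{pmatrix}*&*\\ c&d\end{pmatrix}.$$ Then, for all even $k=2m\ge4$ and all $z\in\mathbb{H}$ one has $$E_{2m}^{(N)}(z)=\frac{1}{\sigma_m(N)}\sum_{v\mid N}v^mE_{2m}(vz),$$ where $E_k$ is the holomorphic Eisenstein series of weight $k$ of $\mathrm{PSL}(2,\mathbb{Z})$.
   Context: $\mathbb{H}$ is the upper half plane. For a square-free positive integer $N$, $$\Gamma_0(N)^+=\left\{ e^{-1/2}\begin{pmatrix} a & b\\ c& d\end{pmatrix}\in \mathrm{SL}(2,\mathbb{R}):\ ad-bc=e,\ a,b,c,d,e\in\mathbb{Z},\ e\mid N,\ e\mid a,\ e\mid d,\ N\mid c\right\}$$ (with $e>0$), and $\Gamma_\infty(N)$ is its parabolic subgroup, the stabilizer of $i\infty$, equal to $\{\pm\begin{pmatrix}1&n\\0&1\end{pmatrix}:n\in\mathbb{Z}\}$. In the definition of $E_k^{(N)}$, $c,d$ are the actual lower-row entries of $\gamma\in\mathrm{SL}(2,\mathbb{R})$. For even $k\ge4$, $$E_k(z)=\sum_{\gamma\in\Gamma_\infty\backslash\mathrm{PSL}(2,\mathbb{Z})}(cz+d)^{-k}=\frac12\sum_{(c,d)\in\mathbb{Z}^2,\ (c,d)=1}(cz+d)^{-k},$$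 where $\Gamma_\infty$ is the group of integral upper triangular unipotent matrices. $\sigma_m(N)=\sum_{\delta\mid N}\delta^m$, and $v$ runs over positive divisors of $N$. *)

(* Defs.v *)
From mathcomp Require Import all_boot all_order all_algebra.
From mathcomp Require Import finmap complex.
From mathcomp Require Import all_classical all_reals all_analysis.
From mathcomp Require Import summability.

Set Implicit Arguments.
Unset Strict Implicit.
Unset Printing Implicit Defensive.

Import Order.TTheory GRing.Theory Num.Theory.
Import numFieldNormedType.Exports.

Local Open Scope classical_set_scope.
Local Open Scope ring_scope.
Local Open Scope complex_scope.

Definition squarefree (N : nat) : Prop :=
  (0 < N)%N /\ forall p : nat, prime p -> ~~ (p ^ 2 %| N)%N.

Definition sigma (m N : nat) : nat := (\sum_(d <- divisors N) d ^ m)%N.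

Definition SL2Z (R : realType) : set 'M[R]_2 :=
  [set g | exists2 A : 'M[int]_2, \det A = 1 & g = map_mx intr A].

(* With A = (a b; c d), the entries A 0 0, A 1 1, A 1 0 are a, d, c, and
   \det A = ad - bc. *)
Definition Gamma0plus (R : realType) (N : nat) : set 'M[R]_2 :=
  [set g | \det g = 1 /\
     exists (e : nat) (A : 'M[int]_2),
       [/\ (0 < e)%N /\ (e %| N)%N,
           \det A = e%:Z,
           (e%:Z %| A 0%R 0%R)%Z /\ (e%:Z %| A 1%R 1%R)%Z,
           (N%:Z %| A 1%R 0%R)%Z &
           g = (Num.sqrt (e%:R : R))^-1 *: map_mx intr A]].

(* The matrices +/- (1 n; 0 1), n an integer.  For square-free N this is the
   stabilizer of i oo in Gamma0plus R N: lower-left entry 0 forces e ^ 2 to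
   divide e.  It is also the preimage in SL(2,Z) of the unipotent upper
   triangular subgroup of PSL(2,Z). *)
Definition Gamma_inf (R : realType) : set 'M[R]_2 :=
  [set g | exists n : int,
     g = 1%:M + n%:~R *: delta_mx 0 1 \/
     g = - (1%:M + n%:~R *: delta_mx 0 1)].

(* H \ G as a set of cosets H g, each one a set of matrices. *)
Definition left_quotient (R : realType) (H G : set 'M[R]_2) :
    set (set 'M[R]_2) :=
  [set [set h *m g | h in H] | g in G].

Definition eisenstein_term (R : realType) (k : nat) (z : R[i])
    (g : 'M[R]_2) : R[i] :=
  ((g 1 0)%:C * z + (g 1 1)%:C) ^- k.

(* Unordered sum over Gamma_inf \ G (limit of the finite partial sums along
   the directed set of finite sets of cosets), evaluated on a chosen
   representative of each coset.  For even k the term does not depend on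
   that choice. *)
Definition eisenstein_sum (R : realType) (G : set 'M[R]_2) (k : nat)
    (z : R[i]) : R[i] :=
  @summability.sum (left_quotient (@Gamma_inf R) G) R[i] R[i]^o
    (fun C => eisenstein_term k z (xget 0 (val C))).

(* Gamma_inf \ SL(2,Z) is the coset space of PSL(2,Z) modulo its unipotent
   upper triangular subgroup, since Gamma_inf contains - 1. *)
Definition eisenstein (R : realType) (k : nat) (z : R[i]) : R[i] :=
  eisenstein_sum (@SL2Z R) k z.

Definition eisenstein_plus (R : realType) (N k : nat) (z : R[i]) : R[i] :=
  eisenstein_sum (@Gamma0plus R N) k z.

(* Main.v *)
Require Import Defs.
From mathcomp Require Import all_boot all_order all_algebra.
From mathcomp Require Import finmap complex.
From mathcomp Require Import all_classical all_reals all_analysis.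
From mathcomp Require Import summability ring lra zify.

Set Implicit Arguments.
Unset Strict Implicit.
Unset Printing Implicit Defensive.

Import Order.TTheory GRing.Theory Num.Theory.
Import numFieldNormedType.Exports.
Local Open Scope ring_scope.
Local Open Scope complex_scope.

(** Every series in the theorem can be written over one and the same index
    set: the primitive integer rows (C, D), taken up to sign.

    Fix such a row and put e = N / gcd(C, N).  Since N is square-free, e is
    coprime to C, so (e C, e D) / sqrt e is the lower row of a matrix of
    Gamma_0(N)^+ (the determinant condition is a Bezout relation between e D
    and C), and every coset of Gamma_inf contains exactly one matrix
    obtained in this way ([cusp_rep_Gamma0plus], [cusp_rep_surj],
    [cusp_rep_inj]).  Hence the weight 2m series of Gamma_0(N)^+ is the sum of
    e^-m (C z + D)^-2m over the rows ([eisenstein_plus_rows]); for N = 1 this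
    is the classical series E_2m ([eisenstein_rows]).

    For a divisor v of N, write w = gcd(C, v) and g = v / w.  The map
    (C, D) |-> (C / w, g D) permutes the rows ([dilate_bij]), and the form of
    the new row at v z is g (C z + D).  Reindexing E_2m(v z) along this
    permutation gives the sum of g^-2m (C z + D)^-2m
    ([eisenstein_dilate_rows]).

    It remains to compare the coefficients of (C z + D)^-2m, that is, to show
    that the sum of v^m g^-2m = (w / g)^m over v | N equals sigma_m(N) e^-m.
    Here g divides e, and v = w g |-> w (e / g) is an involution of the
    divisors of N which turns (w / g)^m into e^-m times the m-th power of a
    divisor ([perm_twist], [sum_divisors_cogcd]).

    Linearity and reindexing of unordered sums need convergence.  It comes
    from |c z + d|^2 >= (c^2 + d^2) / K, which for m >= 2 bounds the terms by a
    constant times 1 / ((1 + c^2) (1 + d^2)) ([has_sum_row]). *)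

(** * Divisors of a square-free integer *)

Lemma divn_dvd (d n : nat) : (d %| n)%N -> (n %/ d %| n)%N.
Proof. by move=> dn; apply/dvdnP; exists d; rewrite mulnC divnK. Qed.

Lemma squarefree_dvd (v N : nat) : squarefree N -> (v %| N)%N -> squarefree v.
Proof.
move=> [N0 sN] vN; split; first exact: dvdn_gt0 vN.
by move=> p /sN; apply: contra => /dvdn_trans; apply.
Qed.

(** The part of N prime to c when N is square-free; it is the determinant e of
    the elements of Gamma_0(N)^+ attached to a row (c, d), and the factor g
    above when N is replaced by its divisor v. *)
Definition cogcd (N c : nat) : nat := N %/ gcdn c N.

Lemma cogcdK (N c : nat) : (cogcd N c * gcdn c N = N)%N.
Proof. by rewrite divnK ?dvdn_gcdr. Qed.

Lemma cogcd_gt0 (N c : nat) : (0 < N)%N -> (0 < cogcd N c)%N.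
Proof. by move=> N0; rewrite divn_gt0 ?gcdn_gt0 ?N0 ?orbT// dvdn_leq// dvdn_gcdr. Qed.

Lemma cogcd_dvd (N c : nat) : (cogcd N c %| N)%N.
Proof. by rewrite -{2}(cogcdK N c) dvdn_mulr. Qed.

(** A prime dividing both c and N / gcd(c, N) also divides gcd(c, N), so its
    square divides N. *)
Lemma coprime_cogcd (N c : nat) : squarefree N -> coprime c (cogcd N c).
Proof.
move=> [N0 sN]; rewrite /coprime; apply/eqP/eqP.
have [//|gn1] := eqVneq (gcdn c (cogcd N c)) 1%N.
have g1 : (1 < gcdn c (cogcd N c))%N.
  by rewrite ltn_neqAle eq_sym gn1 gcdn_gt0 (cogcd_gt0 _ N0) orbT.
have pp := pdiv_prime g1; set p := pdiv _ in pp.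
have := pdiv_dvd (gcdn c (cogcd N c)); rewrite -/p dvdn_gcd => /andP[pc pe].
case/negP: (sN _ pp); rewrite -(cogcdK N c) -mulnn; apply: dvdn_mul => //.
by rewrite dvdn_gcd pc (dvdn_trans pe (cogcd_dvd _ _)).
Qed.

Lemma cogcd_mul (w g c : nat) : (0 < w)%N -> (w %| c)%N -> coprime c g ->
  cogcd (w * g) c = g.
Proof.
move=> w0 wc cg; rewrite /cogcd Gauss_gcdl//.
by move/gcdn_idPr: wc => ->; rewrite mulKn.
Qed.

(** The divisors of N are the products w g with w dividing gcd(c, N) and g
    dividing e = N / gcd(c, N); the twist replaces g by e / g. *)
Definition twist (N c v : nat) : nat :=
  gcdn c v * (cogcd N c %/ cogcd v c).

(** For v dividing N, v / gcd(c, v) divides N = e gcd(c, N) and is coprime to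
    c, hence divides e. *)
Lemma cogcd_dvd_mono (N c v : nat) : squarefree N -> (v %| N)%N ->
  (cogcd v c %| cogcd N c)%N.
Proof.
move=> sN vN; have sv := squarefree_dvd sN vN.
have : (cogcd v c %| N)%N by apply: dvdn_trans vN; apply: cogcd_dvd.
rewrite -{1}(cogcdK N c) Gauss_dvdl//.
rewrite coprime_sym; apply: coprime_dvdl (dvdn_gcdl _ _) _.
exact: coprime_cogcd.
Qed.

Lemma twist_split (N c v : nat) : squarefree N -> (v %| N)%N ->
  gcdn c (twist N c v) = gcdn c v /\
  cogcd (twist N c v) c = (cogcd N c %/ cogcd v c)%N.
Proof.
move=> sN vN; have sv := squarefree_dvd sN vN.
have cop : coprime c (cogcd N c %/ cogcd v c).
  apply: coprime_dvdr (coprime_cogcd c sN).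
  by rewrite -{2}(divnK (cogcd_dvd_mono c sN vN)) dvdn_mulr.
have w0 : (0 < gcdn c v)%N by rewrite gcdn_gt0 (proj1 sv) orbT.
split; last by rewrite cogcd_mul// dvdn_gcdl.
by rewrite /twist Gauss_gcdl//; apply/gcdn_idPr; rewrite dvdn_gcdl.
Qed.

Lemma twist_dvd (N c v : nat) : squarefree N -> (v %| N)%N ->
  (twist N c v %| N)%N.
Proof.
move=> sN vN; rewrite -{2}(cogcdK N c) mulnC; apply: dvdn_mul.
  by rewrite dvdn_gcd dvdn_gcdl (dvdn_trans (dvdn_gcdr _ _) vN).
exact/divn_dvd/cogcd_dvd_mono.
Qed.

Lemma twistK (N c v : nat) : squarefree N -> (v %| N)%N ->
  twist N c (twist N c v) = v.
Proof.
move=> sN vN; have [gE eE] := twist_split c sN vN.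
rewrite /twist -/(twist N c v) gE eE.
have e0 := cogcd_gt0 c (proj1 sN); have d0 := cogcd_gt0 c (proj1 (squarefree_dvd sN vN)).
have vE := cogcd_dvd_mono c sN vN.
rewrite divnA// mulKn// mulnC; exact: cogcdK.
Qed.

Lemma perm_twist (N c : nat) : squarefree N ->
  perm_eq [seq twist N c v | v <- divisors N] (divisors N).
Proof.
move=> sN; have N0 := proj1 sN.
have inj : {in divisors N &, injective (twist N c)}.
  move=> u v; rewrite -!dvdn_divisors// => uN vN /(congr1 (twist N c)).
  by rewrite !twistK.
apply: uniq_perm; rewrite ?divisors_uniq ?map_inj_in_uniq ?divisors_uniq//.
move=> v; apply/mapP/idP => [[u]|]; rewrite -!dvdn_divisors//.
  by move=> uN ->; apply: twist_dvd.
move=> vN; exists (twist N c v); last by rewrite twistK.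
by rewrite -dvdn_divisors// twist_dvd.
Qed.

(** The coefficient identity.  Both sides become sums over the divisors of N
    of an m-th power; the twist matches them term by term, since
    v / g^2 = w / g = (w (e / g)) / e. *)
Lemma sum_divisors_cogcd (F : numFieldType) (N c m : nat) : squarefree N ->
  \sum_(v <- divisors N) v%:R ^+ m * (cogcd v c)%:R ^- (2 * m) =
  (sigma m N)%:R * (cogcd N c)%:R ^- m :> F.
Proof.
move=> sN; rewrite /sigma natr_sum mulr_suml -[in RHS](perm_big _ (perm_twist c sN)).
rewrite big_map big_seq [RHS]big_seq; apply: eq_bigr => v.
rewrite -dvdn_divisors ?(proj1 sN)// => vN.
have e0 : (cogcd N c)%:R != 0 :> F.
  by rewrite pnatr_eq0 -lt0n cogcd_gt0 ?(proj1 sN).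
have g0 : (cogcd v c)%:R != 0 :> F.
  by rewrite pnatr_eq0 -lt0n cogcd_gt0 ?(proj1 (squarefree_dvd sN vN)).
rewrite natrX -exprVn exprM -!exprVn -!exprMn; congr (_ ^+ m).
rewrite -{1}(cogcdK v c) /twist !natrM -{2}(divnK (cogcd_dvd_mono c sN vN)) natrM.
move: (divnK (cogcd_dvd_mono c sN vN)) => /(congr1 (fun n => n%:R : F)).
rewrite natrM => qE.
have q0 : (cogcd N c %/ cogcd v c)%:R != 0 :> F.
  by apply: contraNneq e0 => q0; rewrite -qE q0 mul0r.
by field; rewrite g0 q0.
Qed.

(** * Normalized primitive rows *)

(** The sign of a primitive row is fixed by making its first entry positive,
    or by taking (0, 1).  The rows then correspond to the cusps -d/c of the
    modular group. *)
Definition normalized_row (p : nat * int) : bool :=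
  coprime p.1 `|p.2|%N && ((0 < p.1)%N || (p.2 == 1)).

Notation primrow := {p : nat * int | normalized_row p}.

(** Proportional primitive rows have first entries dividing each other, hence
    equal as they are nonnegative; the normalization settles the rest. *)
Lemma row_eq_cross (p q : primrow) :
  (val p).1%:Z * (val q).2 = (val q).1%:Z * (val p).2 -> p = q.
Proof.
case: p q => [[c d] /= hp] [[c' d'] /= hq] E; apply: val_inj => /=.
have /andP[/= cd hc] := hp; have /andP[/= cd' hc'] := hq.
have Ea : (c * `|d'| = c' * `|d|)%N by move: E => /(congr1 absz); rewrite !abszM.
have cc' : c = c'.
  apply/eqP; rewrite eqn_dvd -(Gauss_dvdl c' cd) -Ea dvdn_mulr//=.
  by rewrite -(Gauss_dvdl c cd') Ea dvdn_mulr.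
move: E hc hc'; rewrite -cc'; case: posnP => [->|c0] /= E.
  by move=> /eqP -> /eqP ->.
move=> _ _; congr pair; apply/esym; apply: mulfI E.
by rewrite eqz_nat -lt0n.
Qed.

Lemma normalized_row_dilate (v : nat) (p : nat * int) : squarefree v ->
  normalized_row p ->
  normalized_row ((p.1 %/ gcdn p.1 v)%N, (cogcd v p.1)%:Z * p.2).
Proof.
case: p => c d /= sv /andP[/= cd hc]; have v0 := proj1 sv.
have w0 : (0 < gcdn c v)%N by rewrite gcdn_gt0 v0 orbT.
apply/andP; split=> /=.
  apply: (@coprime_dvdl _ c).
    by apply: divn_dvd; rewrite dvdn_gcdl.
  by rewrite abszM coprimeMr cd andbT; apply: coprime_cogcd.
case: (posnP c) hc => [-> /= /eqP ->|c0 _].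
  by rewrite div0n ltnn /= mulr1 /cogcd gcd0n divnn v0.
by rewrite divn_gt0// dvdn_leq// dvdn_gcdl.
Qed.

(** The row whose form at v z is a multiple of the form of p at z, namely by
    the factor cogcd v p.1. *)
Definition dilate (v : nat) (sv : squarefree v) (p : primrow) : primrow :=
  exist normalized_row _ (normalized_row_dilate sv (valP p)).

Lemma dilateE (v : nat) (sv : squarefree v) (p : primrow) :
  (v * (val (dilate sv p)).1 = cogcd v (val p).1 * (val p).1)%N /\
  (val (dilate sv p)).2 = (cogcd v (val p).1)%:Z * (val p).2.
Proof.
split=> //=; rewrite -{1}(cogcdK v (val p).1) -mulnA.
by congr muln; rewrite mulnC divnK// dvdn_gcdl.
Qed.

(** Injectivity: the form of the image of (C, D) at v z is proportional to
    C z + D, which determines (C, D).  Surjectivity: (c, d) is the image of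
    (c w, d / g) with g = gcd(v, d) and w = v / g, because v is square-free
    and so w is coprime to g, which gives gcd(c w, v) = w. *)
Lemma dilate_bij (v : nat) (sv : squarefree v) : bijective (dilate sv).
Proof.
have v0 := proj1 sv.
have inj : injective (dilate sv).
  move=> p q E; have [cp dp] := dilateE sv p; have [cq dq] := dilateE sv q.
  rewrite -E in cq dq; apply: row_eq_cross.
  have gp : (cogcd v (val p).1)%:Z != 0 by rewrite eqz_nat -lt0n cogcd_gt0.
  have gq : (cogcd v (val q).1)%:Z != 0 by rewrite eqz_nat -lt0n cogcd_gt0.
  apply: (mulfI gp); apply: (mulfI gq).
  move: dp dq cp cq; move: (cogcd v _) (cogcd v _) gp gq => a b _ _.
  move=> -> dq /(congr1 Posz) cp /(congr1 Posz) cq.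
  rewrite !PoszM in cp cq.
  transitivity (b%:Z * (val p).1%:Z * (a%:Z * (val q).2)); first by ring.
  by rewrite -cp -dq cq; ring.
have surj : forall q : primrow, exists p, dilate sv p == q.
  case=> [[c d] hq]; have /andP[/= cd hc] := hq.
  set g := gcdn v `|d|%N.
  have g0 : (0 < g)%N by rewrite gcdn_gt0 v0.
  have gv : (g %| v)%N := dvdn_gcdl _ _.
  have gd : (g%:Z %| d)%Z by rewrite dvdzE dvdn_gcdr.
  set w := (v %/ g)%N; have vE : v = (w * g)%N by rewrite divnK.
  have w0 : (0 < w)%N by rewrite divn_gt0// dvdn_leq.
  have cg : coprime c g by apply: coprime_dvdr cd; apply: dvdn_gcdr.
  have absd : (`|(d %/ g)%Z| * g = `|d|)%N.
    by rewrite -[g in LHS]/`|g%:Z|%N -abszM divzK.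
  have wd : coprime w `|(d %/ g)%Z|.
    have : gcdn (w * g) (`|(d %/ g)%Z| * g) = g by rewrite -vE absd.
    rewrite -muln_gcdl -[RHS]mul1n => /eqP.
    by rewrite eqn_pmul2r// => /eqP E; rewrite /coprime E.
  have wg : coprime w g.
    rewrite /coprime; apply/eqP/eqP.
    have := coprime_cogcd g sv.
    rewrite /cogcd vE; move/gcdn_idPl: (dvdn_mull w (dvdnn g)) => ->.
    by rewrite mulnK// coprime_sym.
  have hp : normalized_row ((c * w)%N, (d %/ g)%Z).
    apply/andP; split=> /=.
      rewrite coprimeMl wd andbT; apply: coprime_dvdr cd.
      by rewrite -absd dvdn_mulr.
    case: (posnP c) hc => [c0 /= /eqP d1|c0 _]; last by rewrite muln_gt0 c0 w0.
    by rewrite c0 mul0n ltnn /= /g d1 gcdn1 divz1.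
  exists (exist normalized_row _ hp); apply/eqP/val_inj => /=.
  have cogE : cogcd v (c * w) = g.
    by rewrite vE cogcd_mul// ?dvdn_mull// coprimeMl cg.
  have gcdE : gcdn (c * w) v = w.
    have := cogcdK v (c * w); rewrite cogE mulnC {2}vE => /eqP.
    by rewrite eqn_pmul2r// => /eqP.
  by rewrite gcdE cogE mulnK// mulrC divzK.
exists (fun q => xchoose (surj q)) => [p|q]; last first.
  by apply/eqP; exact: (xchooseP (surj q)).
by apply: inj; by apply/eqP; exact: (xchooseP (surj (dilate sv p))).
Qed.

(** * Unordered sums *)

(** Convergence along the finite subsets, in epsilon form: for complex terms
    existence then reduces to the real and imaginary parts, hence to suprema
    of nonnegative real sums. *)
Definition has_sum (K : numFieldType) (I : choiceType) (f : I -> K) (s : K) :=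
  forall eps : K, 0 < eps -> exists A : {fset I}, forall B : {fset I},
    (A `<=` B)%fset -> `|s - \sum_(i <- B) f i| < eps.

Lemma has_sum_lim (K : numFieldType) (I : choiceType) (f : I -> K) (s : K) :
  has_sum f s -> @summability.sum I K K^o f = s.
Proof.
move=> fs; apply: (@cvg_lim K^o); first exact: norm_hausdorff.
  exact: totally_filter.
have FF : Filter (@totally I) by exact: totally_filter.
apply/(@cvgrPdist_lt K K^o) => eps /fs[A AB].
by exists A => // B /AB; rewrite /partial_sum big_seq_fsetE.
Qed.

Lemma has_sumD (K : numFieldType) (I : choiceType) (f g : I -> K) (s t : K) :
  has_sum f s -> has_sum g t -> has_sum (fun i => f i + g i) (s + t).
Proof.
move=> fs gt eps e0; have e2 : 0 < eps / 2 by rewrite divr_gt0.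
have [A hA] := fs _ e2; have [B hB] := gt _ e2.
exists (A `|` B)%fset => C; rewrite fsubUset => /andP[AC BC].
rewrite big_split/= opprD addrACA [eps](splitr eps).
by apply: le_lt_trans (ler_normD _ _) _; rewrite ltrD ?hA ?hB.
Qed.

Lemma has_sumZ (K : numFieldType) (I : choiceType) (f : I -> K) (a s : K) :
  has_sum f s -> has_sum (fun i => a * f i) (a * s).
Proof.
move=> fs eps e0; have a0 : 0 < `|a| + 1 by rewrite ltr_wpDl.
have [A hA] := fs _ (divr_gt0 e0 a0); exists A => B /hA.
rewrite -mulr_sumr -mulrBr normrM ltr_pdivlMr// => h.
apply: le_lt_trans h; rewrite mulrC ler_wpM2l// lerDl//.
Qed.

Lemma has_sum0 (K : numFieldType) (I : choiceType) :
  has_sum (fun _ : I => 0 : K) 0.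
Proof. by move=> eps e0; exists fset0 => B _; rewrite big1// subrr normr0. Qed.

Lemma eq_has_sum (K : numFieldType) (I : choiceType) (f g : I -> K) (s : K) :
  f =1 g -> has_sum f s -> has_sum g s.
Proof. by move=> /funext ->. Qed.

Lemma has_sum_sum (K : numFieldType) (I : choiceType) (J : eqType) (r : seq J)
    (f : J -> I -> K) (s : J -> K) :
  {in r, forall j, has_sum (f j) (s j)} ->
  has_sum (fun i => \sum_(j <- r) f j i) (\sum_(j <- r) s j).
Proof.
elim: r => [_|j r IH fs].
  by rewrite big_nil; apply: eq_has_sum (@has_sum0 _ _) => i; rewrite big_nil.
rewrite big_cons; apply: (@eq_has_sum _ _ (fun i => f j i + \sum_(j <- r) f j i)).
  by move=> i; rewrite big_cons.
apply: has_sumD; first by apply: fs; rewrite mem_head.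
by apply: IH => k kr; apply: fs; rewrite in_cons kr orbT.
Qed.

Lemma has_sum_reindex (K : numFieldType) (I J : choiceType) (h : I -> J)
    (f : J -> K) (s : K) :
  bijective h -> has_sum f s <-> has_sum (f \o h) s.
Proof.
have step (I' J' : choiceType) (k : I' -> J') (k' : J' -> I') (u : J' -> K) :
    cancel k k' -> cancel k' k -> has_sum u s -> has_sum (u \o k) s.
  move=> kK k'K us eps /us[A hA]; exists [fset k' j | j in A]%fset => B AB.
  have -> : \sum_(i <- B) (u \o k) i = \sum_(j <- [fset k i | i in B]%fset) u j.
    by rewrite big_imfset//= => x y _ _; apply: can_inj.
  apply: hA; apply/fsubsetP => j jA; apply/imfsetP.
  exists (k' j); last by rewrite k'K.
  by apply: (fsubsetP AB); apply/imfsetP; exists j.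
case=> h' hK h'K; split; first exact: step.
move=> /(step _ _ _ _ _ h'K hK); apply: eq_has_sum => j /=; by rewrite h'K.
Qed.

(** Induction on s, cancelling each of its terms against one occurrence in t. *)
Lemma ler_sum_subset (R : numDomainType) (I : eqType) (f : I -> R) (s t : seq I) :
  (forall i, 0 <= f i) -> uniq s -> {subset s <= t} ->
  \sum_(i <- s) f i <= \sum_(i <- t) f i.
Proof.
move=> f0; elim: s t => [|x s IH] t /=; first by rewrite big_nil sumr_ge0.
case/andP=> xs us st; have xt : x \in t by apply: st; rewrite mem_head.
rewrite big_cons (big_rem _ xt)/= lerD2l; apply: IH => // y ys.
apply: rem_mem; first by apply: contraNneq xs => <-.
by apply: st; rewrite in_cons ys orbT.
Qed.

Lemma has_sum_nonneg (R : realType) (I : choiceType) (f : I -> R) (M : R) :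
  (forall i, 0 <= f i) -> (forall A : {fset I}, \sum_(i <- A) f i <= M) ->
  exists s, has_sum f s.
Proof.
move=> f0 fM; pose S := [set x | exists A : {fset I}, x = \sum_(i <- A) f i]%classic.
have supS : has_sup S.
  split; first by exists 0, fset0; rewrite big_seq_fset0.
  by exists M => _ [A ->].
exists (sup S) => eps e0.
have [_ [A ->] hA] := sup_adherent e0 supS.
exists A => B AB; have hB : \sum_(i <- B) f i <= sup S.
  by apply: sup_upper_bound => //; exists B.
have := ler_sum_subset f0 (fset_uniq A) (fsubsetP AB).
rewrite ger0_norm ?subr_ge0//; lra.
Qed.

(** f is the difference of the nonnegative families f + g and g. *)
Lemma has_sum_real (R : realType) (I : choiceType) (f g : I -> R) (M : R) :
  (forall i, `|f i| <= g i) -> (forall A : {fset I}, \sum_(i <- A) g i <= M) ->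
  exists s, has_sum f s.
Proof.
move=> fg gM; have fg' i : - g i <= f i <= g i by rewrite -ler_norml.
have g0 i : 0 <= g i by apply: le_trans (fg i).
have [s gs] := has_sum_nonneg g0 gM.
have [||t ht] := @has_sum_nonneg R I (fun i => f i + g i) (M + M).
- by move=> i; have /andP[] := fg' i; lra.
- move=> A; rewrite big_split/= lerD//; apply: le_trans (gM A).
  by apply: ler_sum => i _; have /andP[] := fg' i.
exists (t + (-1) * s); apply: eq_has_sum (has_sumD ht (has_sumZ (-1) gs)).
by move=> i /=; ring.
Qed.

Lemma has_sum_complex (R : realType) (I : choiceType) (f : I -> R[i]) (s t : R) :
  has_sum (fun i => complex.Re (f i)) s -> has_sum (fun i => complex.Im (f i)) t ->
  has_sum f (s +i* t).
Proof.
have realc (u : I -> R) (x : R) : has_sum u x -> has_sum (fun i => (u i)%:C) x%:C.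
  move=> ux eps; rewrite ltcE => /andP[/eqP /= ei er]; have [A hA] := ux _ er.
  exists A => B /hA; rewrite -rmorph_sum -rmorphB/= normc_def/= expr0n addr0 sqrtr_sqr.
  by rewrite ltcE /= ei eqxx.
move=> /realc hs /realc /(has_sumZ 'i) ht; rewrite [_ +i* _]complexE/=.
apply: eq_has_sum (has_sumD hs ht) => i /=; by rewrite -complexE.
Qed.

Lemma has_sum_majorant (R : realType) (I : choiceType) (f : I -> R[i])
    (g : I -> R) (M : R) :
  (forall i, `|f i| <= (g i)%:C) ->
  (forall A : {fset I}, \sum_(i <- A) g i <= M) ->
  exists s, has_sum f s.
Proof.
move=> fg gM.
have reg i : `|complex.Re (f i)| <= g i.
  by have := le_trans (normc_ge_Re _) (fg i); rewrite lecR.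
have img i : `|complex.Im (f i)| <= g i.
  rewrite -normrN -ReiNIm; have := normc_ge_Re (f i * 'i%C).
  rewrite normrM (_ : `|'i%C| = 1) ?mulr1; last first.
    by rewrite normc_def/= expr0n expr1n add0r sqrtr1.
  by move=> /le_trans/(_ (fg i)); rewrite lecR.
have [s hs] := has_sum_real reg gM; have [t ht] := has_sum_real img gM.
by exists (s +i* t); apply: has_sum_complex.
Qed.

(** * Convergence of the sum over the rows *)

(** Telescoping: 1 / (1 + n^2) <= 4 / (n + 1) - 4 / (n + 2). *)
Lemma sum_inv1Dsqr_nat (R : realFieldType) (s : seq nat) : uniq s ->
  \sum_(n <- s) (1 + n%:R ^+ 2)^-1 <= 4 :> R.
Proof.
move=> us; pose M := (\max_(n <- s) n).+1.
have f0 n : 0 <= (1 + n%:R ^+ 2)^-1 :> R by rewrite invr_ge0 addr_ge0// sqr_ge0.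
have sM : {subset s <= index_iota 0 M}.
  by move=> n ns; rewrite mem_index_iota/= ltnS leq_bigmax_seq.
apply: le_trans (ler_sum_subset f0 us sM) _.
pose u n : R := - 4 / n.+1%:R.
apply: (@le_trans _ _ (\sum_(0 <= n < M) (u n.+1 - u n))).
  apply: ler_sum => n _; rewrite /u -[n.+2%:R]natr1 -[n.+1%:R]natr1.
  have n0 : 0 <= n%:R :> R by [].
  set x : R := n%:R in n0 *.
  have -> : - 4 / (x + 1 + 1) - - 4 / (x + 1) = 4 / ((x + 1) * (x + 1 + 1)).
    by field; apply/andP; split; apply: lt0r_neq0; lra.
  rewrite ler_pdivlMr ?ler_pdivrMl; nra.
rewrite telescope_sumr// /u divr1 opprK mulNr addrC lerBlDr lerDl.
by rewrite divr_ge0.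
Qed.

Lemma sum_inv1Dsqr_int (R : realFieldType) (s : seq int) : uniq s ->
  \sum_(n <- s) (1 + n%:~R ^+ 2)^-1 <= 8 :> R.
Proof.
move=> us; rewrite (bigID (fun n : int => 0 <= n))/=.
have half (P : pred int) : (forall x y, P x -> P y -> `|x|%N = `|y|%N -> x = y) ->
    \sum_(n <- s | P n) (1 + n%:~R ^+ 2)^-1 <= 4 :> R.
  move=> inj; rewrite -big_filter.
  have ut : uniq (map absz [seq n <- s | P n]).
    rewrite map_inj_in_uniq ?filter_uniq// => x y.
    by rewrite !mem_filter => /andP[Px _] /andP[Py _]; apply: inj.
  apply: le_trans (sum_inv1Dsqr_nat R ut); rewrite big_map.
  apply: ler_sum => n _.
  by rewrite natr_absz intr_norm real_normK// realz.
rewrite (_ : 8 = 4 + 4) ?lerD//; last by ring.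
  by apply: half => x y; cbv beta; lia.
by apply: half => x y; cbv beta; lia.
Qed.

(** A finite set of rows lies in the product of its two projections, over
    which the sum factors. *)
Lemma sum_inv1Dsqr_row (R : realFieldType) (A : {fset primrow}) :
  \sum_(p <- A) ((1 + (val p).1%:R ^+ 2) * (1 + (val p).2%:~R ^+ 2))^-1 <= 32 :> R.
Proof.
pose f (q : nat * int) : R := ((1 + q.1%:R ^+ 2) * (1 + q.2%:~R ^+ 2))^-1.
have f0 q : 0 <= f q by rewrite invr_ge0 mulr_ge0 ?addr_ge0 ?sqr_ge0.
pose s := [seq val p | p <- A].
pose s1 := undup [seq q.1 | q <- s]; pose s2 := undup [seq q.2 | q <- s].
have sub : {subset s <= [seq (c, d) | c <- s1, d <- s2]}.
  case=> c d cd; apply/allpairsP; exists (c, d); split => //=; rewrite mem_undup.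
    by apply/mapP; exists (c, d).
  by apply/mapP; exists (c, d).
have us : uniq s by rewrite map_inj_uniq ?fset_uniq//; apply: val_inj.
have := ler_sum_subset f0 us sub; rewrite big_map => /le_trans; apply.
rewrite big_allpairs.
have -> : \sum_(c <- s1) \sum_(d <- s2) f (c, d) =
    (\sum_(c <- s1) (1 + c%:R ^+ 2)^-1) * (\sum_(d <- s2) (1 + d%:~R ^+ 2)^-1).
  by rewrite mulr_suml; apply: eq_bigr => c _; rewrite mulr_sumr;
     apply: eq_bigr => d _; rewrite /f invfM.
rewrite (_ : 32 = 4 * 8); last by ring.
by apply: ler_pM; rewrite ?sum_inv1Dsqr_nat ?sum_inv1Dsqr_int ?undup_uniq//;
  apply: sumr_ge0 => ? _; rewrite invr_ge0 addr_ge0// sqr_ge0.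
Qed.

Lemma sqr_norm_row (R : realType) (z : R[i]) (c d : R) :
  `|c%:C * z + d%:C| ^+ 2 =
  ((c * complex.Re z + d) ^+ 2 + (c * complex.Im z) ^+ 2)%:C.
Proof.
by rewrite -add_Re2_Im2; case: z => x y /=; rewrite !mul0r !subr0 !addr0.
Qed.

(** The factor K comes from d^2 <= 2 (c x + d)^2 + 2 c^2 x^2 together with
    c^2 = (c y)^2 / y^2. *)
Lemma row_form_bound (R : realFieldType) (x y c d : R) : 0 < y ->
  c ^+ 2 + d ^+ 2 <=
  (2 + (1 + 2 * x ^+ 2) / y ^+ 2) * ((c * x + d) ^+ 2 + (c * y) ^+ 2).
Proof.
move=> y0; have y2 : y ^+ 2 != 0 by rewrite lt0r_neq0// exprn_gt0.
rewrite mulrDl.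
have -> : (1 + 2 * x ^+ 2) / y ^+ 2 * ((c * x + d) ^+ 2 + (c * y) ^+ 2) =
  (1 + 2 * x ^+ 2) / y ^+ 2 * (c * x + d) ^+ 2 + (1 + 2 * x ^+ 2) * c ^+ 2.
  by field; apply: lt0r_neq0.
have h : 0 <= (1 + 2 * x ^+ 2) / y ^+ 2 * (c * x + d) ^+ 2.
  apply: mulr_ge0; last exact: sqr_ge0.
  by apply: divr_ge0; rewrite ?sqr_ge0// addr_ge0// mulr_ge0// sqr_ge0.
have := sqr_ge0 (c * y); have := sqr_ge0 (2 * c * x + d); nra.
Qed.

(** As S = c^2 + d^2 >= 1 and m >= 2, S^m >= S^2, and
    (1 + c^2) (1 + d^2) = 1 + S + c^2 d^2 <= 3 S^2. *)
Lemma row_inv_bound (R : realFieldType) (K Q c d : R) (m : nat) :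
  (2 <= m)%N -> 0 < K -> 1 <= c ^+ 2 + d ^+ 2 -> c ^+ 2 + d ^+ 2 <= K * Q ->
  Q ^- m <= 3 * K ^+ m * ((1 + c ^+ 2) * (1 + d ^+ 2))^-1.
Proof.
move=> m2 K0 S1 SQ; set S := c ^+ 2 + d ^+ 2 in S1 SQ.
have S0 : 0 < S by apply: lt_le_trans S1.
have Q0 : 0 < Q by rewrite -(pmulr_rgt0 _ K0); apply: lt_le_trans SQ.
have T0 : 0 < (1 + c ^+ 2) * (1 + d ^+ 2).
  by rewrite mulr_gt0// ltr_wpDr ?sqr_ge0.
rewrite -div1r ler_pdivrMr ?exprn_gt0// mulrAC ler_pdivlMr// mul1r.
rewrite -mulrA -exprMn; apply: (@le_trans _ _ (3 * S ^+ m)); last first.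
  by rewrite ler_pM2l// lerXn2r// nnegrE ltW// (lt_le_trans S0).
apply: (@le_trans _ _ (3 * S ^+ 2)); last first.
  by rewrite ler_pM2l// ler_weXn2l.
have := sqr_ge0 c; have := sqr_ge0 d; rewrite /S in S1 *; nra.
Qed.

Lemma has_sum_row (R : realType) (z : R[i]) (m : nat) :
  (2 <= m)%N -> 0 < complex.Im z ->
  exists s, has_sum (fun p : primrow =>
    ((val p).1%:R * z + (val p).2%:~R) ^- (2 * m)) s.
Proof.
move=> m2 y0; set y := complex.Im z in y0; pose x := complex.Re z.
pose K := 2 + (1 + 2 * x ^+ 2) / y ^+ 2.
have K0 : 0 < K.
  rewrite ltr_wpDr// divr_ge0 ?sqr_ge0// addr_ge0// mulr_ge0// sqr_ge0//.
apply: (@has_sum_majorant _ _ _ (fun p => 3 * K ^+ m *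
  ((1 + (val p).1%:R ^+ 2) * (1 + (val p).2%:~R ^+ 2))^-1) (3 * K ^+ m * 32)).
- case=> -[c d] /andP[/= _ cd]; rewrite normfV normrX exprM.
  rewrite -(rmorph_nat (real_complex R)) -(rmorph_int (real_complex R)).
  rewrite sqr_norm_row -rmorphXn -fmorphV/= lecR.
  apply: row_inv_bound => //; last exact: row_form_bound.
  case/orP: cd => [c0|/eqP ->].
    by apply: ler_wpDr; rewrite ?sqr_ge0// -natrX ler1n expn_gt0 c0.
  by rewrite expr1n lerDr sqr_ge0.
- move=> A; rewrite -mulr_sumr ler_wpM2l ?sum_inv1Dsqr_row//.
  by rewrite mulr_ge0// exprn_ge0// ltW.
Qed.

(** * Cosets of Gamma_inf *)

Definition mx2 (T : Type) (a b c d : T) : 'M[T]_2 :=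
  \matrix_(i < 2, j < 2)
    if i == 0 then (if j == 0 then a else b) else (if j == 0 then c else d).

Lemma mx2_ext (T : Type) (A B : 'M[T]_2) :
  A 0 0 = B 0 0 -> A 0 1 = B 0 1 -> A 1 0 = B 1 0 -> A 1 1 = B 1 1 -> A = B.
Proof.
move=> h00 h01 h10 h11; apply/matrixP.
have two (P : 'I_2 -> Prop) : P 0 -> P 1 -> forall i, P i.
  by move=> P0 P1 [[|[|//]] ltn]; [move: P0 | move: P1];
     congr P; apply: val_inj.
by apply: (two (fun i => forall j, A i j = B i j)); apply: (two (fun j => _ = B _ j)).
Qed.

Lemma mx2_eta (T : Type) (A : 'M[T]_2) : A = mx2 (A 0 0) (A 0 1) (A 1 0) (A 1 1).
Proof. by apply: mx2_ext; rewrite mxE. Qed.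

Lemma mulmx2 (R : pzSemiRingType) (a b c d a' b' c' d' : R) :
  mx2 a b c d *m mx2 a' b' c' d' =
  mx2 (a * a' + b * c') (a * b' + b * d') (c * a' + d * c') (c * b' + d * d').
Proof.
by apply: mx2_ext; rewrite !mxE big_ord_recl big_ord1 !mxE.
Qed.

Lemma det_mx2 (R : comPzRingType) (a b c d : R) :
  \det (mx2 a b c d) = a * d - b * c.
Proof.
rewrite (expand_det_row _ 0) big_ord_recl big_ord1 /cofactor !det_mx11 !mxE /=.
by rewrite expr0 expr1 mul1r mulN1r mulrN.
Qed.

Lemma Gamma_infP (R : realType) (h : 'M[R]_2) :
  Gamma_inf h <-> exists (b : bool) (n : int),
    h = map_mx intr (mx2 ((-1) ^+ b) ((-1) ^+ b * n) 0 ((-1) ^+ b)).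
Proof.
have U (n : int) : 1%:M + n%:~R *: delta_mx 0 1 = map_mx intr (mx2 1 n 0 1) :> 'M[R]_2.
  by apply: mx2_ext; rewrite !mxE/= ?(mulr0n, mulr1n, mulr0, mulr1, addr0, add0r).
split=> [[n [->|->]]|[[] [n ->]]].
- by exists false, n; rewrite U expr0 mul1r.
- exists true, n; rewrite U; apply: mx2_ext;
  by rewrite !mxE/= ?expr1 ?rmorphN ?mulN1r ?rmorphN ?oppr0.
- exists n; right; rewrite U; apply: mx2_ext;
  by rewrite !mxE/= ?expr1 ?rmorphN ?mulN1r ?rmorphN ?oppr0.
- by exists n; left; rewrite U expr0 mul1r.
Qed.

Lemma Gamma_inf_1 (R : realType) : Gamma_inf (1%:M : 'M[R]_2).
Proof. by exists 0; left; rewrite scale0r addr0. Qed.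

Lemma Gamma_inf_mul (R : realType) (g h : 'M[R]_2) :
  Gamma_inf g -> Gamma_inf h -> Gamma_inf (g *m h).
Proof.
move=> /Gamma_infP[b [n ->]] /Gamma_infP[b' [n' ->]]; apply/Gamma_infP.
exists (b (+) b'), (n + n'); rewrite -map_mxM mulmx2 signr_addb.
by congr (map_mx _ (mx2 _ _ _ _)); ring.
Qed.

Lemma Gamma_inf_inv (R : realType) (h : 'M[R]_2) :
  Gamma_inf h -> exists2 h', Gamma_inf h' & h' *m h = 1%:M.
Proof.
move=> /Gamma_infP[b [n ->]].
exists (map_mx intr (mx2 ((-1) ^+ b) ((-1) ^+ b * - n) 0 ((-1) ^+ b))).
  by apply/Gamma_infP; exists b, (- n).
rewrite -map_mxM mulmx2 -[RHS](map_mx1 intr); congr map_mx.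
by apply: mx2_ext; rewrite !mxE/=; case: b; rewrite ?expr1 ?expr0; ring.
Qed.

Lemma Gamma_inf_row (R : realType) (h g : 'M[R]_2) : Gamma_inf h ->
  exists b : bool, forall j, (h *m g) 1 j = (-1) ^+ b * g 1 j.
Proof.
move=> /Gamma_infP[b [n ->]]; exists b => j.
rewrite mxE big_ord_recl big_ord1 !mxE/= mulr0z mul0r add0r rmorphXn/= rmorphN1.
by rewrite (_ : lift _ _ = 1)//; apply: val_inj.
Qed.

Lemma eisenstein_term_Gamma_inf (R : realType) (k : nat) (z : R[i]) (h g : 'M[R]_2) :
  ~~ odd k -> Gamma_inf h -> eisenstein_term k z (h *m g) = eisenstein_term k z g.
Proof.
move=> k2 /(Gamma_inf_row g)[b hE]; rewrite /eisenstein_term !hE.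
case: b {hE}; rewrite ?expr0 ?mul1r// expr1 !mulN1r !rmorphN mulNr -opprD.
by rewrite exprNn -signr_odd (negbTE k2) mul1r.
Qed.

(** Since k is even the term depends only on the coset, so the sum over the
    quotient may be computed on any transversal r. *)
Lemma eisenstein_sum_transversal (R : realType) (G : set 'M[R]_2)
    (I : choiceType) (r : I -> 'M[R]_2) (k : nat) (z s : R[i]) :
  ~~ odd k -> (forall i, G (r i)) ->
  (forall g, G g -> exists i h, Gamma_inf h /\ g = h *m r i) ->
  (forall i j h, Gamma_inf h -> r j = h *m r i -> i = j) ->
  has_sum (fun i => eisenstein_term k z (r i)) s ->
  eisenstein_sum G k z = s.
Proof.
move=> k2 Gr rsurj rinj rs; apply: has_sum_lim.
pose coset (g : 'M[R]_2) := [set h *m g | h in @Gamma_inf R]%classic.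
have Gc i : coset (r i) \in left_quotient (@Gamma_inf R) G.
  by apply/mem_set; exists (r i).
pose f i : set_type (left_quotient (@Gamma_inf R) G) := SigSub (Gc i).
have finj : injective f.
  move=> i j /(congr1 val)/= E; have : coset (r j) (r j).
    by exists 1%:M; [apply: Gamma_inf_1 | rewrite mul1mx].
  by rewrite -E => -[h Gh hE]; apply: rinj Gh _.
have fsurj C : exists i, f i == C.
  have /set_mem[g Gg gC] := valP C; have [i [h [Gh gE]]] := rsurj g Gg.
  exists i; apply/eqP/val_inj; rewrite /= -gC gE.
  have [h' Gh' hK] := Gamma_inf_inv Gh.
  apply/seteqP; split=> _ [u Gu <-].
    exists (u *m h'); first exact: Gamma_inf_mul.
    by rewrite mulmxA -(mulmxA u) hK mulmx1.
  by exists (u *m h); [apply: Gamma_inf_mul | rewrite mulmxA].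
have fbij : bijective f.
  exists (fun C => xchoose (fsurj C)) => [i|C]; last first.
    by apply/eqP; exact: (xchooseP (fsurj C)).
  by apply: finj; apply/eqP; exact: (xchooseP (fsurj (f i))).
apply/(has_sum_reindex _ _ fbij); apply: eq_has_sum rs => i /=.
have [h Gh <-] : coset (r i) (xget 0 (coset (r i))).
  by apply: (@xgetI _ _ _ (r i)); exists 1%:M; [apply: Gamma_inf_1 | rewrite mul1mx].
by rewrite eisenstein_term_Gamma_inf.
Qed.

(** * A transversal of Gamma_0(N)^+ *)

Lemma normalize_row (c d : int) : coprimez c d ->
  exists (p : primrow) (b : bool),
    c = (-1) ^+ b * (val p).1%:Z /\ d = (-1) ^+ b * (val p).2.
Proof.
move=> cd; pose b := (c < 0) || (c == 0) && (d < 0).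
have hp : normalized_row (`|c|%N, (-1) ^+ b * d).
  apply/andP; split=> /=; first by rewrite abszMsign.
  have [c0|] := eqVneq c 0; last by move=> c0; rewrite absz_gt0 c0.
  move: cd; rewrite /b c0 /coprimez gcd0z /= => d1; apply/eqP.
  by have [->|->] : d = 1 \/ d = -1 by lia.
exists (exist normalized_row _ hp), b; split=> /=.
  rewrite /b; case: (ltrgtP c 0) => [c0|c0|->];
    rewrite ?mulr0//= ?expr0 ?mul1r ?expr1; lia.
by rewrite signrMK.
Qed.

(** The upper row is a Bezout relation u (e D) + v C = 1, with e = cogcd N C. *)
Definition cusp_mx (N : nat) (p : primrow) : 'M[int]_2 :=
  let e := (cogcd N (val p).1)%:Z in
  let uv := egcdz (e * (val p).2) (val p).1 in
  mx2 (e * uv.1) (- uv.2) (e * (val p).1%:Z) (e * (val p).2).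

Lemma cusp_mxP (N : nat) (p : primrow) : squarefree N ->
  exists u v : int,
    cusp_mx N p = mx2 ((cogcd N (val p).1)%:Z * u) (- v)
      ((cogcd N (val p).1)%:Z * (val p).1%:Z) ((cogcd N (val p).1)%:Z * (val p).2) /\
    u * ((cogcd N (val p).1)%:Z * (val p).2) + v * (val p).1%:Z = 1.
Proof.
move=> sN; rewrite /cusp_mx; case: egcdzP => u v E _; exists u, v; split=> //.
rewrite E; have /andP[cd _] := valP p; apply/eqP.
rewrite -/(coprimez _ _) coprimezE abszM coprimeMl coprime_sym.
by rewrite (coprime_cogcd _ sN) coprime_sym.
Qed.

Definition cusp_rep (R : realType) (N : nat) (p : primrow) : 'M[R]_2 :=
  (Num.sqrt (cogcd N (val p).1)%:R)^-1 *: map_mx intr (cusp_mx N p).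

Lemma cusp_rep_row (R : realType) (N : nat) (p : primrow) : (0 < N)%N ->
  cusp_rep R N p 1 0 = Num.sqrt (cogcd N (val p).1)%:R * (val p).1%:R /\
  cusp_rep R N p 1 1 = Num.sqrt (cogcd N (val p).1)%:R * (val p).2%:~R.
Proof.
move=> N0; rewrite /cusp_rep /cusp_mx; set e := cogcd _ _.
have e0 : 0 < e%:R :> R by rewrite ltr0n cogcd_gt0.
have se0 : Num.sqrt e%:R != 0 :> R by rewrite lt0r_neq0// sqrtr_gt0.
have sE : (Num.sqrt e%:R)^-1 * e%:R = Num.sqrt e%:R :> R.
  by rewrite -{2}(sqr_sqrtr (ltW e0)) expr2 mulKf.
by split; rewrite !mxE/= rmorphM/= mulrA -[(Posz e)%:~R]/(e%:R) sE.
Qed.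

Lemma cusp_rep_Gamma0plus (R : realType) (N : nat) (p : primrow) :
  squarefree N -> Gamma0plus N (cusp_rep R N p).
Proof.
move=> sN; have N0 := proj1 sN; have [u [v [mE uv]]] := cusp_mxP p sN.
rewrite /cusp_rep mE; set e := cogcd _ _ in mE uv *.
have e0 : 0 < e%:R :> R by rewrite ltr0n cogcd_gt0.
set A := mx2 _ _ _ _.
have dA : \det A = e%:Z.
  by rewrite det_mx2 -[RHS]mulr1 -uv; ring.
split.
  rewrite detZ det_map_mx dA exprVn sqr_sqrtr ?ltW//.
  by rewrite mulVf// lt0r_neq0.
exists e, A; split=> //.
- by split; [rewrite cogcd_gt0 | apply: cogcd_dvd].
- by rewrite !mxE/= !dvdz_mulr.
- rewrite mxE/= -PoszM dvdzE/= -{1}(cogcdK N (val p).1) -/e.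
  by rewrite dvdn_mul// dvdn_gcdl.
Qed.

(** The lower rows of the two matrices agree up to sign, so the integer rows
    are proportional, hence equal. *)
Lemma cusp_rep_inj (R : realType) (N : nat) (p q : primrow) (h : 'M[R]_2) :
  (0 < N)%N -> Gamma_inf h -> cusp_rep R N q = h *m cusp_rep R N p -> p = q.
Proof.
move=> N0 /(Gamma_inf_row (cusp_rep R N p))[b hE] E.
have s0 (r : primrow) : Num.sqrt (cogcd N (val r).1)%:R != 0 :> R.
  by rewrite lt0r_neq0// sqrtr_gt0 ltr0n cogcd_gt0.
move: (hE 0) (hE 1); rewrite -E.
have [-> ->] := cusp_rep_row R q N0; have [-> ->] := cusp_rep_row R p N0.
move=> E0 E1; apply/esym/row_eq_cross/(intr_inj (R := R)).
rewrite !rmorphM/= -!pmulrn; move: E0 E1 (s0 p) (s0 q).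
move: (Num.sqrt (cogcd N (val p).1)%:R) (Num.sqrt (cogcd N (val q).1)%:R) => x y.
move: ((val p).1%:R : R) ((val q).1%:R : R) ((val p).2%:~R : R) ((val q).2%:~R : R).
move=> c c' d d' E0 E1 x0 y0.
have w1 : (-1) ^+ b != 0 :> R by rewrite signr_eq0.
apply: (mulfI x0); apply: (mulfI y0); apply: (mulfI w1).
transitivity ((y * c') * ((-1) ^+ b * (x * d))); first by ring.
by rewrite -E1 E0; ring.
Qed.

(** Let the integer matrix of determinant e be (e a, b; N c, e d) with
    N = n e.  Dividing the determinant by e shows that (n c, d) is primitive
    and that e is coprime to n c, so e is the cofactor N / gcd(n c, N) of that
    row.  The given matrix and the representative of this row have the same
    lower row up to sign, hence differ by a real translation, which the two
    Bezout relations show to be by the integer t. *)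
Lemma cusp_rep_surj (R : realType) (N : nat) (g : 'M[R]_2) :
  squarefree N -> Gamma0plus N g ->
  exists p h, Gamma_inf h /\ g = h *m cusp_rep R N p.
Proof.
move=> sN [_ [e [A [[e0 eN] dA [ea ed] Nc gE]]]]; have N0 := proj1 sN.
move: dA; rewrite {1}[A]mx2_eta det_mx2.
have [a aE] : exists a, A 0 0 = e%:Z * a.
  by case/dvdzP: ea => a ->; exists a; rewrite mulrC.
have [d dE] : exists d, A 1 1 = e%:Z * d.
  by case/dvdzP: ed => d ->; exists d; rewrite mulrC.
have [n nE] : exists n, N = (n * e)%N by case/dvdnP: eN => n ->; exists n.
have n0 : (0 < n)%N by move: N0; rewrite nE muln_gt0 => /andP[].
have [c cE] : exists c, A 1 0 = e%:Z * (n%:Z * c).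
  by case/dvdzP: Nc => c ->; exists c; rewrite nE PoszM; ring.
move: (A 0 1) aE dE cE (mx2_eta A) => b -> -> -> AE dA.
have {}dA : e%:Z * a * d - b * (n%:Z * c) = 1.
  apply: (@mulfI _ e%:Z); first by rewrite eqz_nat -lt0n.
  by rewrite mulr1 -[RHS]dA; ring.
have cop x y : e%:Z * a * d - b * (n%:Z * c) = x * y + (n%:Z * c) * (- b) ->
    coprimez (n%:Z * c) x.
  move=> E; apply/coprimezP; exists (- b, y); rewrite /= -dA E; ring.
have cd : coprimez (n%:Z * c) d by apply: (cop _ (e%:Z * a)); ring.
have ce : coprimez (n%:Z * c) e by apply: (cop _ (a * d)); ring.
have [p [s [pc pd]]] := normalize_row cd; exists p.
have cpE : (val p).1 = (n * `|c|)%N by have := congr1 absz pc; rewrite abszMsign abszM.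
have eE : cogcd N (val p).1 = e.
  by rewrite nE cogcd_mul// cpE ?dvdn_mulr//; move: ce; rewrite coprimezE abszM.
have [u [v [mE uv]]] := cusp_mxP p sN; rewrite eE in mE uv.
(* Two matrices of determinant e with the same lower row differ by the
   translation by t, where e t is the determinant formed by their upper rows;
   the factor (-1) ^+ s accounts for the sign of the given matrix. *)
pose t := u * (-1) ^+ s * b + v * (-1) ^+ s * a.
exists (map_mx intr (mx2 ((-1) ^+ s) ((-1) ^+ s * t) 0 ((-1) ^+ s))); split.
  by apply/Gamma_infP; exists s, t.
rewrite gE /cusp_rep eE -scalemxAr -map_mxM mE AE mulmx2; congr (_ *: map_mx _ _).
rewrite pc pd in dA *; rewrite /t; move: (val p).1%:Z (val p).2 uv dA => C D uv dA.
have ss : (-1) ^+ s * (-1) ^+ s = 1 :> int by rewrite -expr2 sqrr_sign.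
move: ((-1) ^+ s : int) ss dA => w ss dA.
(* Each entry identity is an explicit combination of the two Bezout relations
   and of w ^ 2 = 1, where w is the sign. *)
have combine (x y k1 k2 k3 : int) :
    y - x = k1 * (u * (e%:Z * D) + v * C - 1) +
      k2 * (e%:Z * a * (w * D) - b * (w * C) - 1) + k3 * (w * w - 1) -> x = y.
  by rewrite uv dA ss !subrr !mulr0 !addr0 => /eqP; rewrite subr_eq0 => /eqP.
congr mx2.
- apply: (combine _ _ (e%:Z * a) (- (w * e%:Z * u))
    (e%:Z * C * (u * b + v * a) - e%:Z * u * (C * b - e%:Z * a * D))); ring.
- apply: (combine _ _ b (w * v)
    (e%:Z * D * (u * b + v * a) - v * (e%:Z * D * a - b * C))); ring.
- by ring.
- by ring.
Qed.

(** * The Eisenstein series *)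

Lemma eisenstein_term_cusp_rep (R : realType) (N m : nat) (z : R[i]) (p : primrow) :
  (0 < N)%N ->
  eisenstein_term (2 * m) z (cusp_rep R N p) =
  (cogcd N (val p).1)%:R ^- m * ((val p).1%:R * z + (val p).2%:~R) ^- (2 * m).
Proof.
move=> N0; rewrite /eisenstein_term; have [-> ->] := cusp_rep_row R p N0.
rewrite !rmorphM/= rmorph_nat rmorph_int -mulrA -mulrDr exprMn invfM; congr (_^-1 * _).
by rewrite exprM -rmorphXn/= sqr_sqrtr ?ler0n// rmorph_nat.
Qed.

Lemma eisenstein_plus_rows (R : realType) (N m : nat) (z s : R[i]) :
  squarefree N ->
  has_sum (fun p : primrow => (cogcd N (val p).1)%:R ^- m *
    ((val p).1%:R * z + (val p).2%:~R) ^- (2 * m)) s ->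
  eisenstein_plus N (2 * m) z = s.
Proof.
move=> sN hs.
apply: (@eisenstein_sum_transversal R _ primrow (cusp_rep R N)).
- by rewrite mul2n odd_double.
- by move=> p; apply: cusp_rep_Gamma0plus.
- by move=> g; apply: cusp_rep_surj.
- by move=> p q h; apply: cusp_rep_inj; case: sN.
- by apply: eq_has_sum hs => p; rewrite eisenstein_term_cusp_rep//; case: sN.
Qed.

(** This makes the classical series the case N = 1 of the row expansion. *)
Lemma SL2Z_Gamma0plus (R : realType) : @SL2Z R = Gamma0plus 1.
Proof.
apply/seteqP; split=> g.
  move=> [A dA ->]; split; first by rewrite det_map_mx dA.
  by exists 1%N, A; split; rewrite ?dvd1z// sqrtr1 invr1 scale1r.
move=> [_ [e [A [[_]]]]]; rewrite dvdn1 => /eqP -> dA _ _ ->.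
by exists A => //; rewrite sqrtr1 invr1 scale1r.
Qed.

Lemma squarefree1 : squarefree 1.
Proof.
split=> // p pp; rewrite dvdn1 -(exp1n 2) eqn_exp2r//.
by apply: contraTneq pp => ->.
Qed.

Lemma eisenstein_rows (R : realType) (m : nat) (z s : R[i]) :
  has_sum (fun p : primrow =>
    ((val p).1%:R * z + (val p).2%:~R) ^- (2 * m)) s ->
  eisenstein (2 * m) z = s.
Proof.
move=> hs; rewrite /eisenstein SL2Z_Gamma0plus.
apply: (eisenstein_plus_rows squarefree1); apply: eq_has_sum hs => p.
by rewrite /cogcd gcdn1 divn1 expr1n invr1 mul1r.
Qed.

(** The series of E_2m at v z, reindexed along [dilate]: the row of (C, D)
    becomes one whose form at v z is cogcd v C times C z + D. *)
Lemma eisenstein_dilate_rows (R : realType) (v m : nat) (z : R[i]) :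
  squarefree v -> (2 <= m)%N -> 0 < complex.Im z ->
  has_sum (fun p : primrow => (cogcd v (val p).1)%:R ^- (2 * m) *
      ((val p).1%:R * z + (val p).2%:~R) ^- (2 * m))
    (eisenstein (2 * m) (v%:R * z)).
Proof.
move=> sv m2 z0; have v0 := proj1 sv.
have vz0 : 0 < complex.Im (v%:R * z).
  rewrite -(rmorph_nat (real_complex R)); case: z z0 => x y /= y0.
  by rewrite mul0r addr0 mulr_gt0// ltr0n.
have [s hs] := has_sum_row m2 vz0; rewrite (eisenstein_rows hs).
move/(has_sum_reindex _ _ (dilate_bij sv)): hs; apply: eq_has_sum => p /=.
have [cE dE] := dilateE sv p; rewrite -invfM -exprMn mulrA.
congr (_ ^- _); rewrite mulrDr; congr (_ + _); last by rewrite rmorphM.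
by rewrite [RHS]mulrA -!natrM -cE mulnC.
Qed.

Theorem proposition17 (R : realType) (N m : nat) (z : R[i])
    (hN : squarefree N) (hm : (4 <= 2 * m)%N) (hz : 0 < complex.Im z) :
  eisenstein_plus N (2 * m) z =
    (sigma m N)%:R^-1 *
      \sum_(v <- divisors N) v%:R ^+ m * eisenstein (2 * m) (v%:R * z).
Proof.
have m2 : (2 <= m)%N by move: hm; rewrite -[4%N]/(2 * 2)%N leq_pmul2l.
have N0 := proj1 hN; apply: eisenstein_plus_rows => //.
have sum_rows : has_sum (fun p : primrow => (sigma m N)%:R^-1 *
      \sum_(v <- divisors N) v%:R ^+ m * ((cogcd v (val p).1)%:R ^- (2 * m) *
        ((val p).1%:R * z + (val p).2%:~R) ^- (2 * m)))
    ((sigma m N)%:R^-1 *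
      \sum_(v <- divisors N) v%:R ^+ m * eisenstein (2 * m) (v%:R * z)).
  apply/has_sumZ/has_sum_sum => v; rewrite -dvdn_divisors// => vN.
  by apply/has_sumZ/eisenstein_dilate_rows => //; apply: squarefree_dvd vN.
apply: eq_has_sum sum_rows => p.
under eq_bigr do rewrite mulrA.
rewrite -mulr_suml sum_divisors_cogcd// !mulrA mulVf ?mul1r//.
rewrite pnatr_eq0 -lt0n /sigma (big_rem 1%N)/= ?exp1n//.
by rewrite -dvdn_divisors// dvd1n.
Qed.
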